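(* Let $S=\langle n_1,n_2,n_3,n_4\rangle$ be an almost symmetric numerical semigroup with embedding dimension four and type three, and assume that $n_1,n_2,n_3,n_4$ are all odd. Then $\mathrm{PF}(S)=\{f,2f,3f\}$ for some positive integer $f$, and, after a suitable reordering of $n_1,n_2,n_3,n_4$, there exist RF-matrices of $f$ and of $2f$ of the form $$\mathrm{RF}(f)=\begin{pmatrix} -1 & \alpha_2-1 & 0 & 0\\ 0 & -1 & \alpha_3-1 & 0\\ 0&0&-1&\alpha_4-1\\ \alpha_1-1 & 0&0&-1\end{pmatrix},\qquad \mathrm{RF}(2f)=\begin{pmatrix} -1 & \alpha_2-2 & \alpha_3-1 & 0\\ 0 & -1 & \alpha_3-2 & \alpha_4-1\\ \alpha_1-1&0&-1&\alpha_4-2\\ \alpha_1-2 & \alpha_2-1&0&-1\end{pmatrix}.$$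
   Context: For a numerical semigroup $S$ minimally generated by $n_1,\dots,n_4$: $F(S)=\max(\mathbb{Z}\setminus S)$; $\mathrm{PF}(S)$ is the set of integers $f\notin S$ with $f+s\in S$ for all $s\in S\setminus\{0\}$; the type is $t(S)=|\mathrm{PF}(S)|$; $g(S)=|\mathbb{N}\setminus S|$; $S$ is almost symmetric if $2g(S)=F(S)+t(S)$. $\alpha_i$ is the least positive integer such that $\alpha_in_i$ is a non-negative integer combination of the $n_j$, $j\neq i$. An RF-matrix of $f\in\mathrm{PF}(S)$ is a $4\times 4$ integer matrix $(a_{ij})$ with $a_{ii}=-1$, $a_{ij}\ge0$ for $i\ne j$, and $f=\sum_{j}a_{ij}n_j$ for every $i$. *)

(* Defs.v *)
From HB Require Import structures.
From mathcomp Require Import all_boot all_order all_algebra all_fingroup.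
Set Implicit Arguments. Unset Strict Implicit. Unset Printing Implicit Defensive.
Import Order.TTheory GRing.Theory Num.Theory.
Local Open Scope ring_scope.

Definition inS (n : 'I_4 -> nat) (x : int) : Prop :=
  exists c : 'I_4 -> nat, x = ((\sum_(j < 4) c j * n j)%N)%:Z.

Definition inS_without (n : 'I_4 -> nat) (i : 'I_4) (x : int) : Prop :=
  exists c : 'I_4 -> nat, c i = 0%N /\ x = ((\sum_(j < 4) c j * n j)%N)%:Z.

Definition min_gen4_numsgp (n : 'I_4 -> nat) : Prop :=
  (\big[gcdn/0%N]_(j < 4) n j)%N = 1%N /\
  forall i : 'I_4, ~ inS_without n i (n i)%:Z.

Definition is_alpha (n : 'I_4 -> nat) (i : 'I_4) (a : nat) : Prop :=
  (0 < a)%N /\ inS_without n i (a * n i)%N%:Z /\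
  forall b : nat, (0 < b)%N -> (b < a)%N -> ~ inS_without n i (b * n i)%N%:Z.

Definition isPF (n : 'I_4 -> nat) (f : int) : Prop :=
  ~ inS n f /\ forall s : int, inS n s -> s <> 0 -> inS n (f + s).

Definition isFrobenius (n : 'I_4 -> nat) (F : int) : Prop :=
  ~ inS n F /\ forall x : int, F < x -> inS n x.

Definition has_genus (n : 'I_4 -> nat) (g : nat) : Prop :=
  exists gs : seq nat, uniq gs /\ size gs = g /\
    forall x : nat, x \in gs <-> ~ inS n x%:Z.

Definition has_type (n : 'I_4 -> nat) (t : nat) : Prop :=
  exists ps : seq int, uniq ps /\ size ps = t /\
    forall x : int, x \in ps <-> isPF n x.

Definition almost_symmetric (n : 'I_4 -> nat) : Prop :=
  exists (F : int) (g t : nat),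
    isFrobenius n F /\ has_genus n g /\ has_type n t /\
    2 * g%:Z = F + t%:Z.

Definition isRFmatrix (n : 'I_4 -> nat) (f : int) (M : 'M[int]_4) : Prop :=
  forall i : 'I_4,
    M i i = -1 /\
    (forall j : 'I_4, j != i -> 0 <= M i j) /\
    f = \sum_(j < 4) M i j * (n j)%:Z.

Definition mx_of_rows (r : seq (seq int)) : 'M[int]_4 :=
  \matrix_(i < 4, j < 4) nth 0 (nth [::] r i) j.

Definition RF1 (a : 'I_4 -> nat) : 'M[int]_4 :=
  let a k := (a (inord k))%:Z in
  mx_of_rows
   [:: [:: -1; a 1%N - 1; 0; 0];
       [:: 0; -1; a 2%N - 1; 0];
       [:: 0; 0; -1; a 3%N - 1];
       [:: a 0%N - 1; 0; 0; -1]].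

Definition RF2 (a : 'I_4 -> nat) : 'M[int]_4 :=
  let a k := (a (inord k))%:Z in
  mx_of_rows
   [:: [:: -1; a 1%N - 2; a 2%N - 1; 0];
       [:: 0; -1; a 2%N - 2; a 3%N - 1];
       [:: a 0%N - 1; 0; -1; a 3%N - 2];
       [:: a 0%N - 2; a 1%N - 1; 0; -1]].

(* Main.v *)
(* Counting gaps shows PF(S) = {f, f', F} with f + f' = F, and that x or F - x
   lies in S for every integer x other than f and f'.  Taking x = F/2 shows that
   F is odd, so f and f' have opposite parity.  Write i -> j (resp. i => j) if
   f + n_i - n_j (resp. f' + n_i - n_j) lies in S; then for i <> j exactly one of
   i -> j and j => i holds.  If j is the only successor of i for f, then
   f + n_i = (alpha_j - 1) n_j, so alpha_j has the parity of f; the same holds for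
   f'.  Hence no vertex is the unique successor of two vertices, be it for f, for
   f', or once for each.  Few digraphs on four vertices are compatible with this.
   All of them contain either a 4-cycle of unique successors, which forces the
   other number to be the double of the first and yields both RF-matrices, or one
   of two configurations that are impossible: a 2-cycle of unique successors
   (congruences modulo gcd(n_i, n_j)), or an alternating path (half of the even
   number F + n_i lies in S, but F + n_i has a factorization with an odd
   coefficient that is too small to be rewritten into an even one). *)

Require Import Defs.
From HB Require Import structures.
From mathcomp Require Import all_boot all_order all_algebra all_fingroup.
From mathcomp Require Import zify.
From Stdlib Require Import ClassicalEpsilon.
Import Order.TTheory GRing.Theory Num.Theory.
Local Open Scope ring_scope.

Set Implicit Arguments.
Unset Strict Implicit.
Unset Printing Implicit Defensive.

(** * Exhaustive search over digraphs on four vertices *)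

(* Unlike [&&], whose second argument [vm_compute] always evaluates. *)
Notation "a &&& b" := (if a then b else false)
  (at level 60, right associativity).

Notation digraph := ('I_4 -> 'I_4 -> bool).

Definition ord4s : seq 'I_4 :=
  [:: @Ordinal 4 0 isT; @Ordinal 4 1 isT; @Ordinal 4 2 isT; @Ordinal 4 3 isT].

Lemma mem_ord4s i : i \in ord4s.
Proof. by case: i => [[|[|[|[|]]]]]. Qed.

(** If [G] is the digraph of [f], this is that of [f'], by [edge_dual]. *)
Definition dual (G : digraph) : digraph := fun i j => (i != j) &&& (~~ G j i).

Definition only (G : digraph) i j :=
  (i != j) &&& G i j &&& all (fun k => [|| k == i, k == j | ~~ G i k]) ord4s.

(** This and the next two tests are necessary conditions, by [exists_edge], [single_inj] and the
    opposite parities of [f] and [f']. *)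
Definition no_sink (G : digraph) :=
  all (fun i => has (fun j => (j != i) && G i j) ord4s) ord4s.

Definition targets_inj (G : digraph) := all (fun j => all (fun i =>
  if only G i j then all (fun i' => only G i' j ==> (i == i')) ord4s else true)
  ord4s) ord4s.

Definition targets_disj (G H : digraph) := all (fun j => all (fun i =>
  if only G i j then ~~ has (only H ^~ j) ord4s else true) ord4s) ord4s.

Definition cycle4 (G : digraph) i j k l :=
  only G i j &&& only G j k &&& only G k l &&& only G l i.

Definition cycle2 (G H : digraph) i j k l :=
  only G i j &&& only G j i &&&
  [&& ~~ H k l, ~~ H l k & only G k l || only H i l].

Definition altpath (G H : digraph) i j k l :=
  only G i j &&& only H j k &&& (has (only G ^~ l) ord4s || only H i l).

(* [b] tells whether the pseudo-Frobenius number with digraph [G] is odd. *)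
Definition cases b (G H : digraph) i j k l :=
  [|| cycle4 G i j k l, cycle4 H i j k l, cycle2 G H i j k l, cycle2 H G i j k l
    | altpath (if b then G else H) (if b then H else G) i j k l].

Definition quads : seq ('I_4 * 'I_4 * 'I_4 * 'I_4) :=
  [seq q <- [seq (ij.1, ij.2, kl.1, kl.2) |
      ij <- [seq (i, j) | i <- ord4s, j <- ord4s],
      kl <- [seq (k, l) | k <- ord4s, l <- ord4s]]
    | let: (i, j, k, l) := q in uniq [:: i; j; k; l]].

Definition has_case b (G H : digraph) :=
  has (fun q => let: (i, j, k, l) := q in cases b G H i j k l) quads.

Definition admissible (G : digraph) :=
  no_sink G &&& no_sink (dual G) &&& targets_inj G &&& targets_inj (dual G)
    &&& targets_disj G (dual G).

Definition classify b (G : digraph) :=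
  if admissible G then has_case b G (dual G) else true.

(** Twelve bits, three for each source: [unbump i] renumbers the targets other than [i] as 0, 1,
    2. *)
Definition graph_of (s : seq bool) : digraph :=
  fun i j => (i != j) &&& nth false s (3 * i + unbump i j).

Fixpoint bitseqs m : seq bitseq :=
  if m is m'.+1 then [seq c :: s | c <- [:: true; false], s <- bitseqs m'] else [:: [::]].

Lemma mem_bitseqs s : s \in bitseqs (size s).
Proof.
elim: s => [//|c s IH]; apply/allpairsPdep; exists c, s; split => //.
by case: c.
Qed.

Lemma classify_graph_of b s : size s = 12%N -> classify b (graph_of s).
Proof.
move=> ss; suff /allP : all (fun s => classify b (graph_of s)) (bitseqs 12).
  by apply; rewrite -ss mem_bitseqs.
by case: b; vm_compute.
Qed.

Lemma classifyP b (d : digraph) : exists2 G : digraph,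
  forall i j, i != j -> G i j = d i j & classify b G.
Proof.
pose s := flatten [seq [seq d i j | j <- ord4s & j != i] | i <- ord4s].
exists (graph_of s); last exact: classify_graph_of.
move=> i j; move: (mem_ord4s i) (mem_ord4s j); rewrite !inE.
by move=> /or4P[]/eqP-> /or4P[]/eqP->.
Qed.

(** The same four indices occur in many orders; permuted lists are recognized by comparing
    counts. *)
Ltac uniq4 := match goal with
  H : is_true (@uniq _ ?s) |- is_true (@uniq _ ?t) =>
    solve [rewrite (@perm_uniq _ t s) //; apply/seq.permP => ? /=; lia]
  end.

Ltac neq4 := match goal with
  H : is_true (@uniq _ ?s) |- is_true (?a != ?b) =>
    solve [move: H; rewrite /= !inE !negb_or -!andbA;
      do 6![case/andP=> ?] => _; first [done | by rewrite eq_sym]]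
  end.

(** * Membership in [S], with the four indices in any order *)

Section FourGenerators.

Variable n : 'I_4 -> nat.

Lemma enum4_perm (i j k l : 'I_4) :
  uniq [:: i; j; k; l] -> perm_eq (index_enum 'I_4) [:: i; j; k; l].
Proof.
move=> Uq; rewrite perm_sym; apply: uniq_perm => //; first exact: index_enum_uniq.
have sub : {subset [:: i; j; k; l] <= index_enum 'I_4}.
  by move=> x _; rewrite mem_index_enum.
have [] // := uniq_min_size Uq sub.
by rewrite /index_enum -enumT size_enum_ord.
Qed.

Lemma sum4 (i j k l : 'I_4) (c : 'I_4 -> nat) : uniq [:: i; j; k; l] ->
  (\sum_(x < 4) c x * n x)%N
  = (c i * n i + (c j * n j + (c k * n k + c l * n l)))%N.
Proof.
by move=> Uq; rewrite (perm_big _ (enum4_perm Uq)) unlock /= addn0.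
Qed.

Lemma inS4P (i j k l : 'I_4) (x : int) : uniq [:: i; j; k; l] ->
  inS n x <-> exists p q r s : nat,
    x = (p * n i + q * n j + r * n k + s * n l)%N%:Z.
Proof.
move=> Uq; split=> [[c ->]|[p [q [r [s ->]]]]].
  by exists (c i), (c j), (c k), (c l); rewrite (sum4 _ Uq) !addnA.
exists (fun t => if t == i then p else if t == j then q else
                 if t == k then r else s).
move: (Uq); rewrite /= !inE !negb_or => /and4P[/and3P[ij ik il] /andP[jk jl] kl _].
rewrite (sum4 _ Uq) !eqxx.
by rewrite (eq_sym j i) (eq_sym k i) (eq_sym l i) (eq_sym k j) (eq_sym l j) (eq_sym l k)
  (negPf ij) (negPf ik) (negPf il) (negPf jk) (negPf jl) (negPf kl) !addnA.
Qed.

Lemma inS_without4P (i j k l : 'I_4) (x : int) : uniq [:: i; j; k; l] ->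
  inS_without n i x <-> exists q r s : nat,
    x = (q * n j + r * n k + s * n l)%N%:Z.
Proof.
move=> Uq; split=> [[c [ci0 ->]]|[q [r [s ->]]]].
  by exists (c j), (c k), (c l); rewrite (sum4 _ Uq) ci0 mul0n add0n !addnA.
exists (fun t => if t == i then 0%N else if t == j then q else
                 if t == k then r else s).
move: (Uq); rewrite /= !inE !negb_or => /and4P[/and3P[ij ik il] /andP[jk jl] kl _].
split; first by rewrite eqxx.
rewrite (sum4 _ Uq) !eqxx.
by rewrite (eq_sym j i) (eq_sym k i) (eq_sym l i) (eq_sym k j) (eq_sym l j) (eq_sym l k)
  (negPf ij) (negPf ik) (negPf il) (negPf jk) (negPf jl) (negPf kl) !addnA.
Qed.

Lemma ord4_complete (i j : 'I_4) : i != j ->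
  exists k l : 'I_4, uniq [:: i; j; k; l].
Proof.
case: i j => [[|[|[|[|?]]]] Hi] [[|[|[|[|?]]]] Hj] //= _;
by [ exists (inord 0), (inord 1); rewrite /= !inE -!val_eqE /= !inordK
   | exists (inord 0), (inord 2); rewrite /= !inE -!val_eqE /= !inordK
   | exists (inord 0), (inord 3); rewrite /= !inE -!val_eqE /= !inordK
   | exists (inord 1), (inord 2); rewrite /= !inE -!val_eqE /= !inordK
   | exists (inord 1), (inord 3); rewrite /= !inE -!val_eqE /= !inordK
   | exists (inord 2), (inord 3); rewrite /= !inE -!val_eqE /= !inordK].
Qed.

Lemma ord4_complete1 (i : 'I_4) : exists j k l : 'I_4, uniq [:: i; j; k; l].
Proof.
have [j ij] : exists j : 'I_4, i != j.
  by case: (altP (i =P ord0)) => [->|]; [exists ord_max | exists ord0].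
by have [k [l ?]] := ord4_complete ij; exists j, k, l.
Qed.

Lemma inS_gen i : inS n (n i)%:Z.
Proof.
have [j [k [l Uq]]] := ord4_complete1 i.
by apply/(inS4P _ Uq); exists 1%N, 0%N, 0%N, 0%N; lia.
Qed.

Lemma inSD x y : inS n x -> inS n y -> inS n (x + y).
Proof.
move=> [c ->] [d ->]; exists (fun t => (c t + d t)%N).
by rewrite -PoszD -big_split; congr (Posz _); apply: eq_bigr => t _; rewrite mulnDl.
Qed.

Lemma inS0 : inS n 0.
Proof. by exists (fun=> 0%N); rewrite big1. Qed.

Lemma inS_ge0 x : inS n x -> 0 <= x.
Proof. by case=> c ->. Qed.

End FourGenerators.

(** * Minimality of the [alpha i] *)

Section Edges.

Variables (n alpha : 'I_4 -> nat).
Hypothesis n_min : forall i, ~ inS_without n i (n i)%:Z.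
Hypothesis alphaP : forall i, is_alpha n i (alpha i).
Hypothesis n_odd : forall i, odd (n i).

Implicit Types (g x : int) (i j k l : 'I_4).

Lemma n_gt0 i : (0 < n i)%N.
Proof. by move: (n_odd i); case: (n i). Qed.

Lemma n_inj i j : n i = n j -> i = j.
Proof.
move=> nij; apply/eqP; apply: contraT => ij; case: (n_min (i := i)).
have [k [l Uq]] := ord4_complete ij.
by apply/(inS_without4P _ _ Uq); exists 1%N, 0%N, 0%N; rewrite nij; lia.
Qed.

Lemma alpha_min i j k l b p q r : uniq [:: i; j; k; l] -> (0 < b)%N ->
  (b * n i = p * n j + q * n k + r * n l)%N -> (alpha i <= b)%N.
Proof.
move=> Uq b0 E; rewrite leqNgt; apply/negP => lt_b.
have [_ [_ /(_ b b0 lt_b)]] := alphaP i; apply.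
by apply/(inS_without4P _ _ Uq); exists p, q, r; rewrite E.
Qed.

Lemma alpha_rel i j k l : uniq [:: i; j; k; l] ->
  exists p q r, (alpha i * n i = p * n j + q * n k + r * n l)%N.
Proof.
move=> Uq; have [_ [/(inS_without4P _ _ Uq)[p [q [r E]]] _]] := alphaP i.
by exists p, q, r; case: E.
Qed.

Lemma alpha_gt1 i : (1 < alpha i)%N.
Proof.
have [a0 [aS _]] := alphaP i; rewrite ltn_neqAle a0 andbT.
by apply/eqP => a1; apply: (n_min (i := i)); move: aS; rewrite -a1 mul1n.
Qed.

Lemma alpha_minz i j k l (b p q r : int) : uniq [:: i; j; k; l] -> 0 < b ->
  0 <= p -> 0 <= q -> 0 <= r ->
  b * (n i)%:Z = p * (n j)%:Z + q * (n k)%:Z + r * (n l)%:Z ->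
  (alpha i)%:Z <= b.
Proof.
move=> Uq; case: b => b //; case: p => p //; case: q => q //; case: r => r //.
by move=> b0 _ _ _ E; apply: (alpha_min Uq b0 (p := p) (q := q) (r := r)); lia.
Qed.

(** A positive coefficient on the right makes [b] positive, so [b] may be a difference of unknown
    sign. *)
Lemma alpha_minz_pos i j k l (b p q r : int) : uniq [:: i; j; k; l] ->
  0 < p -> 0 <= q -> 0 <= r ->
  b * (n i)%:Z = p * (n j)%:Z + q * (n k)%:Z + r * (n l)%:Z ->
  (alpha i)%:Z <= b.
Proof.
move=> Uq p0 q0 r0 E; apply: (alpha_minz Uq _ (ltW p0) q0 r0 E).
rewrite -(@pmulr_lgt0 _ (n i)%:Z); last exact: n_gt0.
by rewrite E !ltr_wpDr ?mulr_ge0 ?mulr_gt0 // ltz_nat n_gt0.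
Qed.

Lemma inS_comb i j k l x (p q r s : int) : uniq [:: i; j; k; l] ->
  0 <= p -> 0 <= q -> 0 <= r -> 0 <= s ->
  x = p * (n i)%:Z + q * (n j)%:Z + r * (n k)%:Z + s * (n l)%:Z -> inS n x.
Proof.
move=> Uq; case: p => p //; case: q => q //; case: r => r //; case: s => s // *.
by apply/(inS4P _ _ Uq); exists p, q, r, s; lia.
Qed.

Lemma inS_step x : inS n x -> x <> 0 -> exists j, inS n (x - (n j)%:Z).
Proof.
have [j [k [l Uq]]] := ord4_complete1 ord0.
move=> /(inS4P _ _ Uq)[p [q [r [s ->]]]] nz.
case: (posnP p) => [p0|p0]; last first.
  by exists ord0; apply: (inS_comb (p := p%:Z - 1) (q := q) (r := r) (s := s) Uq); lia.
case: (posnP q) => [q0|q0]; last first.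
  by exists j; apply: (inS_comb (p := p) (q := q%:Z - 1) (r := r) (s := s) Uq); lia.
case: (posnP r) => [r0|r0]; last first.
  by exists k; apply: (inS_comb (p := p) (q := q) (r := r%:Z - 1) (s := s) Uq); lia.
have s0 : (0 < s)%N by rewrite lt0n; apply/eqP => s0; apply: nz; subst.
by exists l; apply: (inS_comb (p := p) (q := q) (r := r) (s := s%:Z - 1) Uq); lia.
Qed.

(** * The digraph of a pseudo-Frobenius number *)

Definition quasiPF g := [/\ 0 < g, ~ inS n g & forall i, inS n (g + (n i)%:Z)].

(** Equivalently, [n j] occurs in some factorization of [g + n i]. *)
Definition edge g i j := inS n (g + (n i)%:Z - (n j)%:Z).

Definition single g i j :=
  [/\ i != j, edge g i j & forall k, k != i -> edge g i k -> k = j].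

(** A factorization of [g + n i] using [n i] would cancel to one of [g]. *)
Lemma row_rep g i j k l : quasiPF g -> uniq [:: i; j; k; l] ->
  exists p q r : nat, g + (n i)%:Z = (p * n j + q * n k + r * n l)%N%:Z.
Proof.
move=> [_ gS gP] Uq; have /(inS4P _ _ Uq)[p [q [r [s E]]]] := gP i.
exists q, r, s; case: (posnP p) => [p0|p0]; first by rewrite E p0.
by case: gS; apply: (inS_comb (p := p%:Z - 1) (q := q) (r := r) (s := s) Uq); lia.
Qed.

Lemma row_rep2 g i j k l : quasiPF g -> uniq [:: i; j; k; l] -> ~ edge g i l ->
  exists p q : nat, g + (n i)%:Z = (p * n j + q * n k)%N%:Z.
Proof.
move=> gQ Uq nl; have [p [q [r E]]] := row_rep gQ Uq; exists p, q.
case: (posnP r) => [r0|r0]; first by rewrite E r0; lia.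
have Ul : uniq [:: l; i; j; k] by uniq4.
by case: nl; apply: (inS_comb (p := r%:Z - 1) (q := 0) (r := p) (s := q) Ul); lia.
Qed.

Lemma exists_edge g i : quasiPF g -> exists2 j, j != i & edge g i j.
Proof.
move=> gQ; have [g0 gS gP] := gQ.
have [|j Ej] := inS_step (gP i); first by have := n_gt0 i; lia.
exists j => //; apply/eqP => ji; apply: gS; move: Ej; rewrite ji.
by congr inS; lia.
Qed.

Lemma single_rep g i j : quasiPF g -> single g i j ->
  g + (n i)%:Z = ((alpha j)%:Z - 1) * (n j)%:Z.
Proof.
move=> gQ [ij Eij sij]; have [g0 gS gP] := gQ.
have [k [l Uq]] := ord4_complete ij.
have Uk : uniq [:: k; i; j; l] by uniq4.
have Ul : uniq [:: l; i; j; k] by uniq4.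
have Uj : uniq [:: j; i; k; l] by uniq4.
have nk : ~ edge g i k.
  by move/sij => /(_ ltac:(neq4))/eqP; apply/negP; neq4.
have nl : ~ edge g i l.
  by move/sij => /(_ ltac:(neq4))/eqP; apply/negP; neq4.
have [p [q E]] := row_rep2 gQ Uq nl.
have q0 : q = 0%N.
  case: (posnP q) => // q0; case: nk.
  by apply: (inS_comb (p := q%:Z - 1) (q := 0) (r := p) (s := 0) Uk); lia.
have {q0} E : g + (n i)%:Z = p%:Z * (n j)%:Z by rewrite E q0; lia.
suff : (alpha j <= p.+1 /\ p < alpha j)%N by move=> ?; have -> : alpha j = p.+1; lia.
split.
  (* Adding [n i] to row [j] gives a relation for [(p + 1) n j]. *)
  have [a [b [c Ej]]] := row_rep gQ Uj.
  have // : (alpha j)%:Z <= p%:Z + 1; last by lia.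
  by apply: (alpha_minz (p := a%:Z + 1) (q := b) (r := c) Uj); lia.
(* Otherwise substituting the minimal relation of [n j] brings in a generator that cannot occur in
   [g + n i]. *)
rewrite ltnNge; apply/negP => le_p.
have [a [b [c Ea]]] := alpha_rel Uj.
have Ep : g + (n i)%:Z = (p%:Z - (alpha j)%:Z) * (n j)%:Z
    + (a%:Z * (n i)%:Z + b%:Z * (n k)%:Z + c%:Z * (n l)%:Z) by lia.
case: (posnP a) => [a0|a0]; last first.
  by apply: gS; apply: (inS_comb (p := a%:Z - 1) (q := p%:Z - (alpha j)%:Z)
    (r := b) (s := c) Uq); lia.
case: (posnP b) => [b0|b0]; last first.
  by apply: nk; apply: (inS_comb (p := b%:Z - 1) (q := a)
    (r := p%:Z - (alpha j)%:Z) (s := c) Uk); lia.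
case: (posnP c) => [c0|c0]; last first.
  by apply: nl; apply: (inS_comb (p := c%:Z - 1) (q := a)
    (r := p%:Z - (alpha j)%:Z) (s := b) Ul); lia.
have : (0 < alpha j * n j)%N by rewrite muln_gt0 n_gt0 ltnW ?alpha_gt1.
by rewrite Ea a0 b0 c0.
Qed.

Lemma single_odd g i j : quasiPF g -> single g i j ->
  odd (alpha j) = odd `|g|%N.
Proof.
move=> gQ /(single_rep gQ); have := n_odd i; have := n_odd j.
by lia.
Qed.

Lemma single_inj g i i' j : quasiPF g -> single g i j -> single g i' j -> i = i'.
Proof.
move=> gQ /(single_rep gQ) E /(single_rep gQ) E'; apply: n_inj; lia.
Qed.

(** [g + g'] stands for the Frobenius number. The conditions are symmetric in [g] and [g'], so each
    later argument serves both. *)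
Definition dualPair g g' :=
  [/\ quasiPF g, quasiPF g', ~ inS n (g + g'), odd `|g|%N != odd `|g'|%N
    & forall x, [\/ inS n x, inS n (g + g' - x), x = g | x = g']].

Lemma dualPair_sym g g' : dualPair g g' -> dualPair g' g.
Proof.
case=> gQ gQ' FS od sym; split => //; first by rewrite addrC.
  by rewrite eq_sym.
move=> x; rewrite (addrC g' g).
by case: (sym x); [constructor 1 | constructor 2 | constructor 4 | constructor 3].
Qed.

(** The two elements add up to [g + g'], so not both lie in [S]. Conversely, [g + n i - n j] is not
    [g], as the generators are distinct, nor [g'], by parity. *)
Lemma edge_dual g g' i j : dualPair g g' -> i != j ->
  edge g i j <-> ~ edge g' j i.
Proof.
case=> _ _ FS od sym ij; rewrite /edge; split=> [E E'|E'].
  by apply: FS; have := inSD E E'; congr inS; lia.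
have [//|E|E|E] := sym (g + (n i)%:Z - (n j)%:Z).
- by case: E'; move: E; congr inS; lia.
- by case/eqP: ij; apply: n_inj; lia.
- by have := n_odd i; have := n_odd j; move/eqP: od; lia.
Qed.

(** * Excluding alternating paths *)

(** Cancelling common terms of two different factorizations would contradict the minimality of
    [alpha j], [alpha k] or [alpha l]. *)
Lemma factor_base i j k l (X Y p r q : nat) : uniq [:: i; j; k; l] ->
  (X < alpha j)%N -> (Y < alpha k)%N -> (q < alpha l)%N ->
  (p * n j + r * n k + q * n l = X * n j + Y * n k)%N ->
  q = 0%N /\ p = X.
Proof.
move=> Uq Xj Yk ql E.
have Uj : uniq [:: j; k; l; i] by uniq4.
have Uk : uniq [:: k; j; l; i] by uniq4.
have Ul : uniq [:: l; j; k; i] by uniq4.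
case: (ltnP X p) => pX.
  suff: (alpha k)%:Z <= Y%:Z - r%:Z by lia.
  by apply: (alpha_minz_pos (p := p%:Z - X%:Z) (q := q) (r := 0) Uk); lia.
case: (ltnP Y r) => rY.
  suff: (alpha j)%:Z <= X%:Z - p%:Z by lia.
  by apply: (alpha_minz_pos (p := r%:Z - Y%:Z) (q := q) (r := 0) Uj); lia.
case: (posnP q) => [q0|q0]; last first.
  suff: (alpha l)%:Z <= q%:Z by lia.
  by apply: (alpha_minz (p := X%:Z - p%:Z) (q := Y%:Z - r%:Z) (r := 0) Ul); lia.
split=> //; apply/eqP; rewrite eqn_leq pX leqNgt; apply/negP => ltX.
suff: (alpha k)%:Z <= r%:Z - Y%:Z by lia.
by apply: (alpha_minz_pos (p := X%:Z - p%:Z) (q := 0) (r := 0) Uk); lia.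
Qed.

(** Trading [alpha l] copies of [n l] at a time for [u n j + v n k] leads to [factor_base]; [t]
    counts the trades. *)
Lemma factor_shift i j k l (u v X Y p r q : nat) : uniq [:: i; j; k; l] ->
  (X < alpha j)%N -> (Y < alpha k)%N ->
  (alpha l * n l = u * n j + v * n k)%N ->
  (p * n j + r * n k + q * n l = X * n j + Y * n k)%N ->
  exists t : nat, q = (t * alpha l)%N /\ (p + t * u = X)%N.
Proof.
move=> Uq Xj Yk El; have al := alpha_gt1 l.
elim/ltn_ind: q p r => q IH p r E.
case: (ltnP q (alpha l)) => ql.
  by have [-> ->] := factor_base Uq Xj Yk ql E; exists 0%N; split; lia.
have [||t [Et Ep]] := IH (q - alpha l)%N _ (p + u)%N (r + v)%N; first by lia.
  have : (alpha l * n l <= q * n l)%N by rewrite leq_mul2r ql orbT.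
  by rewrite -E mulnBl El; lia.
by exists t.+1; split; lia.
Qed.

(* [g + g' + n i] is even, so half of it lies in [S] and gives a factorization
   with even coefficients; the one read off from the two edges is odd. *)
Lemma no_alternating_path g g' i j k l : dualPair g' g -> odd `|g'|%N ->
  uniq [:: i; j; k; l] -> single g' i j -> single g j k ->
  (exists m, single g' m l) \/ single g i l -> False.
Proof.
move=> D od' Uq Sij Sjk Sl; have [gQ' gQ FS od sym] := D.
have Eij := single_rep gQ' Sij; have Ejk := single_rep gQ Sjk.
have oj : odd (alpha j) by rewrite (single_odd gQ' Sij).
have [aj ak] := (alpha_gt1 j, alpha_gt1 k).
have ni := n_odd i.
have [w Hw] : exists w : int, 2 * w = g' + g + (n i)%:Z.
  exists (((g' + g + (n i)%:Z) %/ 2)%Z); clear -od od' ni; move: od; rewrite od'; lia.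
(* With [F = g' + g]: if [F - w] lies in [S], so does [w = (F - w) + n i]; if [w] is [g] or [g'],
   then [g] and [g'] differ by [n i], so one of them lies in [S]. *)
have wS : inS n w.
  have [//|||] := sym w.
  - move=> H; have := inSD H (inS_gen n i); congr inS; lia.
  - move=> H; case: gQ' => _ H' _; case: H'; have [_ _ /(_ i)] := gQ; congr inS; lia.
  - move=> H; case: gQ => _ H' _; case: H'; have [_ _ /(_ i)] := gQ'; congr inS; lia.
have /(inS4P _ _ Uq)[c [p [r [q Epr]]]] := wS.
have noni (a b d e : int) : 0 < a -> 0 <= b -> 0 <= d -> 0 <= e ->
    g' + g + (n i)%:Z
      = a * (n i)%:Z + b * (n j)%:Z + d * (n k)%:Z + e * (n l)%:Z -> False.
  move=> a0 b0 d0 e0 Ea; apply: FS.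
  by apply: (inS_comb (p := a - 1) (q := b) (r := d) (s := e) Uq); lia.
have c0 : c = 0%N.
  case: (posnP c) => // c0; exfalso.
  by apply: (noni (2 * c%:Z) (2 * p%:Z) (2 * r%:Z) (2 * q%:Z)); lia.
(* The right side adds the rows of the two edges; [alpha j - 2] is odd. *)
have E2 : (p.*2 * n j + r.*2 * n k + q.*2 * n l
           = (alpha j - 2) * n j + (alpha k - 1) * n k)%N.
  by move: (alpha j) (alpha k) aj ak Eij Ejk => [|[|x]] // [|[|y]] //=;
     rewrite !subSS !subn0; lia.
have Xj : (alpha j - 2 < alpha j)%N by lia.
have Yk : (alpha k - 1 < alpha k)%N by lia.
have Ul : uniq [:: l; i; j; k] by uniq4.
(* Either [alpha l] is odd like [g'], or adding [n i] to row [l] of [g] gives a relation containing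
   [n i]. *)
have [d [u [v [El dP]]]] : exists d u v,
    (alpha l * n l = d * n i + u * n j + v * n k)%N /\ ((0 < d)%N \/ odd (alpha l)).
  case: Sl => [[m Sm]|Sil].
    have [d [u [v E]]] := alpha_rel Ul; exists d, u, v; split=> //.
    by right; rewrite (single_odd gQ' Sm).
  have [d [u [v E]]] := row_rep gQ Ul.
  have Eil := single_rep gQ Sil.
  by exists d.+1, u, v; split; [lia | left].
(* If [d = 0], then [alpha l] is odd, so the number of trades is even and cannot make up for the odd
   [alpha j - 2]. *)
case: (posnP d) => [d0|d0].
  case: dP => [|ol]; first by rewrite d0.
  have El' : (alpha l * n l = u * n j + v * n k)%N by rewrite El d0; lia.
  have [t [Et Ep]] := factor_shift Uq Xj Yk El' E2.
  have /negPf ot : ~~ odd t.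
    by have := congr1 odd Et; rewrite odd_double oddM ol andbT => <-.
  by have := congr1 odd Ep; rewrite oddD odd_double oddM ot /= oddB // oj.
(* If [d > 0], a single trade brings [n i] into a factorization of [F + n i], forcing [F] into
   [S]. *)
case: (ltnP q.*2 (alpha l)) => ql.
  by have [_ Ep] := factor_base Uq Xj Yk ql E2; have := congr1 odd Ep;
     rewrite odd_double oddB // oj.
by apply: (noni d (2 * p%:Z + u%:Z) (2 * r%:Z + v%:Z) (2 * q%:Z - (alpha l)%:Z)); lia.
Qed.

(** * Arithmetic of 2-cycles of unique successors *)

(** Multiply a Bezout relation for [h = gcd(n i, n j)] by [n l] and reduce the coefficient of [n i]
    modulo [alpha i], using [alpha i n i = alpha j n j]. The result either expresses [h n l] by
    [n i] and [n j] or puts [g] into [S]. *)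
Lemma alpha_le_gcd g i j k l : quasiPF g -> uniq [:: i; j; k; l] ->
  single g i j -> single g j i -> (alpha l <= gcdn (n i) (n j))%N.
Proof.
move=> gQ Uq /(single_rep gQ) Ei /(single_rep gQ) Ej.
have [_ gS _] := gQ.
have Ul : uniq [:: l; i; j; k] by uniq4.
have ni := n_gt0 i; have ai := alpha_gt1 i.
have Eij : (alpha i * n i = alpha j * n j)%N by lia.
have h0 : (0 < gcdn (n i) (n j))%N by rewrite gcdn_gt0 ni.
have [b _ /dvdnP[a Eab]] := Bezoutl (n j) ni; set h := gcdn _ _ in h0 Eab *.
have := divn_eq (a * n l) (alpha i); have := ltn_pmod (a * n l) (ltnW ai).
set t := ((a * n l) %/ _)%N; set c := ((a * n l) %% _)%N => ca Ec.
have Eh : (h * n l + b * n l * n j = c * n i + t * alpha j * n j)%N.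
  have : ((h + b * n j) * n l = a * n i * n l)%N by rewrite Eab.
  have : (a * n l * n i = (t * alpha i + c) * n i)%N by rewrite {1}Ec.
  have : (t * (alpha i * n i) = t * (alpha j * n j))%N by rewrite Eij.
  by lia.
case: (leqP (b * n l) (t * alpha j)) => bt.
  suff : (alpha l)%:Z <= h%:Z by [].
  by apply: (alpha_minz (p := c) (q := t%:Z * (alpha j)%:Z - b%:Z * (n l)%:Z)
    (r := 0) Ul); lia.
by case: gS; apply: (inS_comb (p := h) (q := (alpha i)%:Z - 1 - c%:Z)
  (r := b%:Z * (n l)%:Z - t%:Z * (alpha j)%:Z - 1) (s := 0) Ul); lia.
Qed.

Lemma dvdn_int (h m : nat) (e : int) : m%:Z = h%:Z * e -> (h %| m)%N.
Proof.
by move=> /(congr1 absz); rewrite abszM => /= ->; apply: dvdn_mulr.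
Qed.

(** * 4-cycles of unique successors *)

(** The edge from [l] to [i] keeps [n l] out of row [i] of [g']; subtract that row from the sum of
    rows [i] and [j] of [g]. *)
Lemma cycle4_row g g' i j k l : dualPair g g' -> uniq [:: i; j; k; l] ->
  single g i j -> single g j k -> single g k l -> single g l i ->
  exists p q : nat, [/\ (p < alpha j)%N, (q < alpha k)%N
    & 2 * g - g' = (p * n j + q * n k)%N%:Z].
Proof.
move=> D Uq Sij Sjk Skl Sli; have [gQ gQ' _ od _] := D.
have Ei := single_rep gQ Sij; have Ej := single_rep gQ Sjk.
have Ek := single_rep gQ Skl.
have [aj ak al] := And3 (alpha_gt1 j) (alpha_gt1 k) (alpha_gt1 l).
have li : l != i by neq4.
have nil : ~ edge g' i l by apply/(edge_dual D li); case: Sli.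
have Ul : uniq [:: l; j; k; i] by uniq4.
have [a [b E]] := row_rep2 gQ' Uq nil.
(* Otherwise [g' - g] lies in [S] and is nonzero by parity, which puts [g'] into [S]. *)
have la : (a <= alpha j - 2)%N.
  rewrite leqNgt; apply/negP => la.
  have sS : inS n (g' - g).
    by apply: (inS_comb (p := 0) (q := a%:Z - ((alpha j)%:Z - 1)) (r := b)
      (s := 0) Ul); lia.
  have [|m sm] := inS_step sS; first by move: od => /eqP; clear; lia.
  have [_ _ /(_ m) gm] := gQ; have [_ gS' _] := gQ'.
  by apply: gS'; have := inSD sm gm; congr inS; lia.
(* Otherwise [alpha k n k = n j + (alpha l - 1) n l] brings [n l] into row [i] of [g']. *)
have lb : (b <= alpha k - 1)%N.
  rewrite leqNgt; apply/negP => lb; apply: nil.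
  by apply: (inS_comb (p := (alpha l)%:Z - 2) (q := a%:Z + 1)
    (r := b%:Z - (alpha k)%:Z) (s := 0) Ul); lia.
exists (alpha j - 2 - a)%N, (alpha k - 1 - b)%N; split; [lia | lia |].
by rewrite PoszD !PoszM -!subzn //; lia.
Qed.

(** Rotating the cycle expresses [2 g - g'] by different pairs of consecutive generators with small
    coefficients; comparing overlapping pairs ([cmp]) makes the coefficients vanish. *)
Lemma cycle4_double g g' i j k l : dualPair g g' -> uniq [:: i; j; k; l] ->
  single g i j -> single g j k -> single g k l -> single g l i -> g' = 2 * g.
Proof.
move=> D Uq Sij Sjk Skl Sli.
have cmp a b c d (p q p' q' : nat) : uniq [:: a; b; c; d] ->
    (p < alpha b)%N -> (q < alpha c)%N -> (p' < alpha c)%N -> (q' < alpha d)%N ->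
    (p * n b + q * n c = p' * n c + q' * n d)%N -> (p = 0 /\ q' = 0)%N.
  move=> U pb qc pc qd E.
  have Ub : uniq [:: b; c; d; a] by uniq4.
  have Ud : uniq [:: d; b; c; a] by uniq4.
  have Uc : uniq [:: c; b; d; a] by uniq4.
  case: (ltnP q p') => qp.
    suff: (alpha b)%:Z <= p%:Z by lia.
    by apply: (alpha_minz_pos (p := p'%:Z - q%:Z) (q := q') (r := 0) Ub); lia.
  case: (posnP q') => [q0|q0]; last first.
    suff: (alpha d)%:Z <= q'%:Z by lia.
    by apply: (alpha_minz (p := p) (q := q%:Z - p'%:Z) (r := 0) Ud); lia.
  split=> //; case: (posnP p) => // p0.
  suff: (alpha c)%:Z <= p'%:Z - q%:Z by lia.
  by apply: (alpha_minz_pos (p := p) (q := 0) (r := 0) Uc); lia.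
have Uj : uniq [:: j; k; l; i] by uniq4.
have Ul : uniq [:: l; i; j; k] by uniq4.
have [p [q [pj qk E]]] := cycle4_row D Uq Sij Sjk Skl Sli.
have [p' [q' [pk ql E']]] := cycle4_row D Uj Sjk Skl Sli Sij.
have [p'' [q'' [pi qj E'']]] := cycle4_row D Ul Sli Sij Sjk Skl.
have [p0 _] := cmp _ _ _ _ _ _ _ _ Uq pj qk pk ql ltac:(lia).
have [_ q0] := cmp _ _ _ _ _ _ _ _ Ul pi qj pj qk ltac:(lia).
by move: E; rewrite p0 q0; lia.
Qed.

(** * Excluding 2-cycles *)

Hypothesis n_gcd : (\big[gcdn/0]_(j < 4) n j)%N = 1%N.

Lemma no_2cycle g g' i j k l : dualPair g g' -> uniq [:: i; j; k; l] ->
  single g i j -> single g j i -> ~ edge g' k l -> ~ edge g' l k ->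
  single g k l \/ single g' i l -> False.
Proof.
move=> D Uq Sij Sji nkl nlk Sl; have [gQ gQ' _ od _] := D.
have le_h := alpha_le_gcd gQ Uq Sij Sji.
have Ei := single_rep gQ Sij; have Ej := single_rep gQ Sji.
have [ai al] := (alpha_gt1 i, alpha_gt1 l).
have [oi oj] := (single_odd gQ Sji, single_odd gQ Sij).
(* Otherwise [alpha i n i = alpha j n j] could be halved. *)
have og : odd `|g|%N.
  apply: contraT => og; move: (og) (og); rewrite -{1}oi -oj => oi' oj'.
  have Ei2 : alpha i = (alpha i)./2.*2 by rewrite even_halfK.
  have Ej2 : alpha j = (alpha j)./2.*2 by rewrite even_halfK.
  suff : (alpha i)%:Z <= (alpha i)./2%:Z by lia.
  by apply: (alpha_minz (p := (alpha j)./2) (q := 0) (r := 0) Uq); lia.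
set h := gcdn (n i) (n j) in le_h.
have /dvdnP[a Ea] : (h %| n i)%N by apply: dvdn_gcdl.
have /dvdnP[b Eb] : (h %| n j)%N by apply: dvdn_gcdr.
have oh : odd h by have := n_odd i; rewrite Ea oddM => /andP[].
have Uk : uniq [:: k; i; j; l] by uniq4.
have Ul : uniq [:: l; i; j; k] by uniq4.
have [c Ec] : exists c : int, g' + (n k)%:Z = h%:Z * c.
  have [p [q E]] := row_rep2 gQ' Uk nkl; exists ((p * a + q * b)%N%:Z).
  by rewrite E Ea Eb; lia.
have [d Ed] : exists d : int, g' + (n l)%:Z = h%:Z * d.
  have [p [q E]] := row_rep2 gQ' Ul nlk; exists ((p * a + q * b)%N%:Z).
  by rewrite E Ea Eb; lia.
(* [n k] and [n l] are congruent modulo [h], so a common divisor of [h] and [n l] divides all four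
   generators. *)
have cop : coprime h (n l).
  rewrite /coprime -dvdn1 -n_gcd; apply/dvdn_biggcdP => m _.
  have [hh hl] := (dvdn_gcdl h (n l), dvdn_gcdr h (n l)).
  have : m \in [:: i; j; k; l] by rewrite -(perm_mem (enum4_perm Uq)) mem_index_enum.
  rewrite !inE => /or4P[] /eqP-> //; [by rewrite Ea dvdn_mull|by rewrite Eb dvdn_mull|].
  move: hh hl => /dvdnP[u Eu] /dvdnP[v Ev]; set e := gcdn _ _ in Eu Ev *.
  by apply: (@dvdn_int _ _ (u%:Z * (c - d) + v%:Z)); lia.
case: Sl => [Skl | Sil].
  have Ekl := single_rep gQ Skl; have ol := single_odd gQ Skl.
  have : (h %| (alpha l - 2) * n l)%N.
    apply: (@dvdn_int _ _ (((alpha j)%:Z - 1) * b%:Z - a%:Z + c - d)).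
    by rewrite PoszM -subzn //; lia.
  rewrite Gauss_dvdl // => hl.
  have al2 : alpha l = 2%N.
    case: (posnP (alpha l - 2)) => [|l2]; first by lia.
    by have := dvdn_leq l2 hl; lia.
  by move: og; rewrite -ol al2.
have Eil := single_rep gQ' Sil; have ol := single_odd gQ' Sil.
have : (h %| alpha l * n l)%N.
  by apply: (@dvdn_int _ _ (a%:Z + d)); rewrite PoszM; lia.
rewrite Gauss_dvdl // => hl.
have := dvdn_leq (ltnW al) hl => le_h'.
have ehl : alpha l = h by lia.
by move: od; rewrite og -ol ehl oh.
Qed.

(** * From the search to a 4-cycle *)

Lemma onlyP g (G : digraph) i j :
  (forall i j, i != j -> G i j <-> edge g i j) -> only G i j -> single g i j.
Proof.
move=> GP /and3P[ij Gij /allP sij]; split=> //; first exact/GP.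
move=> k ki /GP Gik; move: (sij k (mem_ord4s k)).
by rewrite (negPf ki) Gik ?orbF 1?eq_sym // => /eqP.
Qed.

Lemma exists_single_cycle f f' : dualPair f f' ->
  exists g g' i j k l, [/\ dualPair g g', g + g' = f + f', g = f \/ g = f',
    uniq [:: i; j; k; l]
    & [/\ single g i j, single g j k, single g k l & single g l i]].
Proof.
move=> D; have D' := dualPair_sym D; have [fQ fQ' _ od _] := D.
(* Edges are made Boolean classically, so that the search applies. *)
pose d i j : bool := if excluded_middle_informative (edge f i j) then true else false.
have [G Gd] := classifyP (odd `|f|%N) d.
have GP i j : i != j -> G i j <-> edge f i j.
  by move=> ij; rewrite (Gd _ _ ij) /d; case: excluded_middle_informative.
have HP i j : i != j -> dual G i j <-> edge f' i j.
  move=> ij; rewrite /dual ij; rewrite (edge_dual D' ij) -GP 1?eq_sym //.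
  by split=> /negP.
have GS i j : only G i j -> single f i j by exact: onlyP.
have HS i j : only (dual G) i j -> single f' i j by exact: onlyP.
have sinkP g (K : digraph) : quasiPF g ->
    (forall i j, i != j -> K i j <-> edge g i j) -> no_sink K.
  move=> gQ KP; apply/allP => i _; apply/hasP.
  have [j ji Eij] := exists_edge i gQ; exists j; first exact: mem_ord4s.
  by rewrite ji; apply/KP => //; rewrite eq_sym.
have injP g (K : digraph) : quasiPF g ->
    (forall i j, only K i j -> single g i j) -> targets_inj K.
  move=> gQ KS; apply/allP => j _; apply/allP => i _; case Kij: (only K i j) => //.
  apply/allP => i' _; apply/implyP => Kij'.
  by apply/eqP; apply: (single_inj gQ); apply: KS; [apply: Kij|].
have adm : admissible G.
  rewrite /admissible (sinkP f) // (sinkP f') // (injP f) // (injP f') //.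
  apply/allP => j _; apply/allP => i _; case Gij: (only G i j) => //.
  apply/hasPn => i' _; apply/negP => Hij.
  have := single_odd fQ (GS _ _ Gij); have := single_odd fQ' (HS _ _ Hij).
  by move=> -> E; rewrite E eqxx in od.
rewrite /classify adm => /hasP[[[[i j] k] l]].
rewrite mem_filter => /andP[Uq _].
have T g g' (K L : digraph) : dualPair g g' ->
    (forall i j, only K i j -> single g i j) ->
    (forall i j, only L i j -> single g' i j) ->
    (forall i j, i != j -> L i j <-> edge g' i j) -> ~ cycle2 K L i j k l.
  move=> Dg KS LS LP /and4P[/KS Sij /KS Sji nkl /andP[nlk Sl]].
  apply: (no_2cycle Dg Uq Sij Sji).
  - by move/LP => /(_ ltac:(neq4)) E; rewrite E in nkl.
  - by move/LP => /(_ ltac:(neq4)) E; rewrite E in nlk.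
  - by case/orP: Sl => [/KS|/LS]; [left|right].
have A g g' (K L : digraph) : dualPair g' g -> odd `|g'|%N ->
    (forall i j, only K i j -> single g' i j) ->
    (forall i j, only L i j -> single g i j) -> ~ altpath K L i j k l.
  move=> Dg og KS LS /and3P[/KS Sij /LS Sjk Sl].
  apply: (no_alternating_path Dg og Uq Sij Sjk).
  by case/orP: Sl => [/hasP[m _ /KS]|/LS]; [left; exists m|right].
case/or4P=> [/and4P[? ? ? ?]|/and4P[? ? ? ?]|/T c|/orP[/T c|]].
- by exists f, f', i, j, k, l; split; auto; split; apply: GS.
- by exists f', f, i, j, k, l; split; auto; [rewrite addrC|split; apply: HS].
- by case: (c f f').
- by case: (c f' f).
(* The alternating path starts with an edge of whichever number is odd. *)
- case of_ : odd => /A c; first by case: (c f' f).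
  case: (c f f') => //; move: od; rewrite of_; by case: odd.
Qed.

End Edges.

(** * From almost symmetry to a dual pair *)

(* Counting gaps: the [F - s] with [s] in [S] and the pseudo-Frobenius numbers
   other than [F] are distinct gaps, and [2 g = F + t] says that there are no
   others. *)
Lemma almost_symmetric_dualPair (n : 'I_4 -> nat) :
  (forall i, odd (n i)) -> almost_symmetric n -> has_type n 3 ->
  exists f f', dualPair n f f' /\
    forall x, isPF n x <-> [\/ x = f, x = f' | x = f + f'].
Proof.
move=> n_odd [F [g [t [[FS Fmax] [[gs [Ugs [sgs gsP]]] [tP Eg]]]]]].
move=> [ps [Ups [sps psP]]].
have t3 : t = 3%N.
  case: tP => ps' [Ups' [<- psP']]; rewrite -sps; apply/perm_size/uniq_perm => //.
  by move=> x; apply/idP/idP => [/psP'/psP|/psP/psP'].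
rewrite t3 in Eg.
(* If [F < 0], there are no gaps, so [F = -3] and [-2] would lie in [S]. *)
have F0 : 0 <= F.
  rewrite leNgt; apply/negP => F0.
  have g0 : g = 0%N.
    rewrite -sgs; case: gs {Ugs sgs} gsP => // x s /(_ x)[].
    by rewrite mem_head => /(_ isT) []; apply: Fmax; lia.
  by have /inS_ge0 : inS n (-2) by [apply: Fmax; lia].
have PFgap x : isPF n x -> 0 < x.
  move=> [xS xP]; case: (ltrgt0P x) => // [x0|x0]; last by case: xS; rewrite x0; exact: inS0.
  have FxS : inS n (F - x) by apply: Fmax; lia.
  by case: FS; have := xP _ FxS; rewrite [x + _]addrC subrK; apply; lia.
have PFsym x : isPF n x -> x <> F -> ~ inS n (F - x).
  move=> [xS xP] xF FxS; case: FS; have := xP _ FxS.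
  by rewrite [x + _]addrC subrK; apply; lia.
have FPF : isPF n F.
  by split=> // s /inS_ge0 s0 sn; apply: Fmax; lia.
have Fps : F \in ps by apply/psP.
have [f [f' [nff' Eps]]] : exists f f', f != f' /\ rem F ps = [:: f; f'].
  have := size_rem Fps; have := rem_uniq F Ups; rewrite sps.
  by case: (rem F ps) => [|f [|f' []]] //=; rewrite inE => /andP[ff' _] _; exists f, f'.
have fP x : isPF n x <-> [\/ x = f, x = f' | x = F].
  have E : (x \in ps) = [|| x == f, x == f' | x == F].
    by rewrite (perm_mem (perm_to_rem Fps)) Eps !inE orbC orbA.
  rewrite -psP E; split=> [/or3P[]/eqP|[]] ->; rewrite ?eqxx ?orbT //.
  - by constructor 1. - by constructor 2. - by constructor 3.
have FN y : y \in [:: f; f'] -> [/\ isPF n y & y <> F].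
  move=> yf; split; first by apply/psP; apply: (@mem_rem _ F); rewrite Eps.
  by move=> yF; move: yf; rewrite yF -Eps mem_rem_uniq // !inE eqxx.
have [fPF fF] := FN f (mem_head _ _).
have [fPF' fF'] := FN f' ltac:(by rewrite !inE eqxx orbT).
have [f0 f0'] := (PFgap _ fPF, PFgap _ fPF').
case: F F0 {Fps psP Eps} FS Fmax Eg PFgap PFsym FPF fP FN fF fF' => // m _.
move=> FS Fmax Eg PFgap PFsym FPF fP FN fF fF'.
have gsm x : x \in gs -> (x <= m)%N.
  by move/gsP => xS; rewrite leqNgt; apply/negP => xm; apply: xS; apply: Fmax.
pose X := [seq (m - x)%N | x <- iota 0 m.+1 & x \notin gs].
have Ssub x : x \notin gs -> inS n x%:Z.
  by move=> xg; case: (classic (inS n x%:Z)) => // /gsP xg'; rewrite xg' in xg.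
have XP x : x \in X -> (x <= m)%N /\ inS n (m%:Z - x%:Z).
  move=> /mapP[y]; rewrite mem_filter mem_iota => /andP[/Ssub yS ym] ->.
  by split; [lia | move: yS; congr inS; lia].
pose Y := X ++ [:: `|f|%N; `|f'|%N].
have UY : uniq Y.
  rewrite cat_uniq; apply/and3P; split.
  - rewrite map_inj_in_uniq ?filter_uniq ?iota_uniq // => x y.
    by rewrite !mem_filter !mem_iota; lia.
  - apply/hasPn => y yf; apply/negP => /XP[_ yS].
    have [z zf yz] : exists2 z, z \in [:: f; f'] & y%:Z = z.
      by move: yf; rewrite !inE => /orP[]/eqP->; [exists f | exists f'];
        rewrite ?inE ?eqxx ?orbT //; lia.
    by have [zP zF] := FN z zf; apply: (PFsym z zP zF); rewrite -yz.
  - by rewrite /= andbT inE; lia.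
have Ygs : {subset Y <= gs}.
  move=> y; rewrite mem_cat => /orP[/XP[ym yS]|yf]; apply/gsP.
    by move=> yS'; apply: FS; have := inSD yS yS'; rewrite subrK.
  have [z zf ->] : exists2 z, z \in [:: f; f'] & y%:Z = z.
    by move: yf; rewrite !inE => /orP[]/eqP->; [exists f | exists f'];
      rewrite ?inE ?eqxx ?orbT //; lia.
  by have [[]] := FN z zf.
have sX : (size X + g = m.+1)%N.
  have -> : g = count (mem gs) (iota 0 m.+1).
    rewrite -sgs -size_filter; apply/perm_size/uniq_perm; rewrite ?filter_uniq ?iota_uniq //.
    by move=> x; rewrite mem_filter mem_iota /=; case xg: (x \in gs) => //=; have := gsm _ xg; lia.
  by rewrite size_map size_filter addnC (count_predC (mem gs)) size_iota.
(* [Y] has [(m + 1 - g) + 2 = g] elements, all of them gaps. *)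
have [_ Ymem] : (size gs = size Y /\ Y =i gs).
  have := uniq_min_size UY Ygs; rewrite sgs size_cat /= => H.
  by case: H => [|-> H]; [lia | split].
have dualF x : [\/ inS n x, inS n (m%:Z - x), x = f | x = f'].
  case: (classic (inS n x)) => xS; first by constructor 1.
  case: x xS => [x|x] xS; last by constructor 2; apply: Fmax; lia.
  have : x \in Y by rewrite Ymem; apply/gsP.
  rewrite mem_cat !inE => /or3P[/XP[_ ?]|/eqP E|/eqP E].
  - by constructor 2. - by constructor 3; lia. - by constructor 4; lia.
(* [F - f] and [F - f'] can only be [f] or [f']; having both [F = 2 f] and [F = 2 f'] would give
   [f = f']. *)
have Ff : m%:Z = f + f'.
  have := dualF (m%:Z - f); have := dualF (m%:Z - f').
  have := PFsym f fPF fF; have := PFsym f' fPF' fF'.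
  have [fS _] := fPF; have [fS' _] := fPF'.
  rewrite !subKr => n1 n2 [] // E1 [] // E2; move: nff' => /eqP; lia.
have quasi y : isPF n y -> quasiPF n y.
  move=> yP; split; [exact: PFgap | by case: yP |] => i; case: yP => _; apply.
    exact: inS_gen.
  by have := n_gt0 n_odd i; lia.
exists f, f'; split; last by move=> x; rewrite -Ff.
rewrite /dualPair -Ff; split; [exact: quasi | exact: quasi | by [] | | by []].
(* With equal parities [F] is even, and its half [h], being equal to [F - h] and outside [S], is [f]
   or [f']; then [f = f']. *)
apply/eqP => od.
have [h Eh] : exists h : int, m%:Z = 2 * h by exists (m%:Z %/ 2)%Z; lia.
have hS : ~ inS n h by move=> hS; apply: FS; have := inSD hS hS; congr inS; lia.
by move: nff' => /eqP; case: (dualF h) => // E; try lia; case: hS; move: E; congr inS; lia.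
Qed.

Theorem theorem5p2 (n : 'I_4 -> nat) (alpha : 'I_4 -> nat) :
  min_gen4_numsgp n ->
  (forall i : 'I_4, is_alpha n i (alpha i)) ->
  almost_symmetric n ->
  has_type n 3 ->
  (forall i : 'I_4, odd (n i)) ->
  exists f : int,
    0 < f /\
    (forall x : int, isPF n x <-> (x = f \/ x = 2 * f \/ x = 3 * f)) /\
    exists s : 'S_4,
      isRFmatrix (fun i => n (s i)) f (RF1 (fun i => alpha (s i))) /\
      isRFmatrix (fun i => n (s i)) (2 * f) (RF2 (fun i => alpha (s i))).
Proof.
move=> [n_gcd n_min] alphaP AS T3 n_odd.
have [f [f' [D PFP]]] := almost_symmetric_dualPair n_odd AS T3.
have [g [g' [i [j [k [l [Dg Egf gf Uq [Sij Sjk Skl Sli]]]]]]]] :=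
  exists_single_cycle n_min alphaP n_odd n_gcd D.
have Eg' := cycle4_double n_min alphaP n_odd Dg Uq Sij Sjk Skl Sli.
have [gQ _ _ _ _] := Dg; have [g0 _ _] := gQ.
have Ei := single_rep n_min alphaP n_odd gQ Sij.
have Ej := single_rep n_min alphaP n_odd gQ Sjk.
have Ek := single_rep n_min alphaP n_odd gQ Skl.
have El := single_rep n_min alphaP n_odd gQ Sli.
exists g; split=> //; split.
  move=> x; rewrite PFP.
  by case: gf => Eg; split=> [[]|[|[]]] ->; try lia; by
    [constructor 1; lia | constructor 2; lia | constructor 3; lia].
(* The reordering lists the generators along the 4-cycle. *)
pose q := [:: i; j; k; l]; pose s0 (a : 'I_4) := nth i q a.
have s0_inj : injective s0.
  move=> a b /eqP; rewrite /s0 nth_uniq // => /eqP; exact: ord_inj.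
exists (perm s0_inj).
have a1 := alpha_gt1 n_min alphaP.
have [ai aj ak al] := And4 (a1 i) (a1 j) (a1 k) (a1 l).
have [s0E s1E s2E s3E] : [/\ s0 (inord 0) = i, s0 (inord 1) = j,
    s0 (inord 2) = k & s0 (inord 3) = l] by rewrite /s0 !inordK.
have sumE (c : 'I_4 -> int) : \sum_(b < 4) c b * (n (s0 b))%:Z
    = c (inord 0) * (n i)%:Z + c (inord 1) * (n j)%:Z
    + c (inord 2) * (n k)%:Z + c (inord 3) * (n l)%:Z.
  rewrite !big_ord_recl big_ord0 addr0 !addrA.
  by do ![congr (_ + _)]; congr (c _ * _); apply: val_inj; rewrite /= inordK.
(* Each row of [RF2] is the sum of the same row of [RF1] and the cyclically next one; [alpha > 1]
   makes the entries non-negative. *)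
split=> a; under eq_bigr do rewrite permE;
  rewrite /RF1 /RF2 /mx_of_rows !permE s0E s1E s2E s3E sumE !mxE !inordK //;
  case: a => [[|[|[|[|]]]]] //= Ha; do 2![split=> //]; try lia;
  by move=> b; rewrite -val_eqE mxE; case: b => [[|[|[|[|]]]]] //=; lia.
Qed.
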